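(* Let $(\Omega,\Sigma,\mu)$ be a measure space with $\mu:\Sigma\to[0,\infty]$ a locally determined positive measure, let $X$ be a Banach space over $\mathbb{K}$ ($\mathbb{R}$ or $\mathbb{C}$), let $F:\Omega\to X$ be locally Pettis integrable, and let $\nu_F:\Sigma^f\to X$ be the vector measure $\nu_F(B)=\mathbb{P}\text{-}\int_B F\,d\mu$, $B\in\Sigma^f$. Let $g\in L^0(\Sigma)$. Then: (i) $g\in L^1_w(\nu_F)$ if and only if $gF\in\mathbb{D}(\mu,X)$. Moreover the map $M_F: g\mapsto gF$, restricted to $L^1_w(\nu_F)$, is a linear isometry from $L^1_w(\nu_F)$ into $\mathbb{D}(\mu,X)$. (ii) $g\in L^1(\nu_F)$ if and only if $gF\in\mathbb{P}(\mu,X)$. Moreover the restriction $M_F:L^1(\nu_F)\to\mathbb{P}(\mu,X)$ is a linear isometry such that $I_{\nu_F}=I_{\mathbb{P}}\circ M_F$, where $I_{\nu_F}(g)=\int_\Omega g\,d\nu_F$ and $I_{\mathbb{P}}(G)=\mathbb{P}\text{-}\int_\Omega G\,d\mu$.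
   Context: $\Omega$ is a nonempty set, $\Sigma$ a $\sigma$-algebra on $\Omega$, $\Sigma^f=\{B\in\Sigma:\mu(B)<\infty\}$. $X^*$ is the dual of $X$ and $B_{X^*}$ its unit ball. $\mu$ is semi-finite if every $A\in\Sigma$ with $\mu(A)>0$ contains $B\in\Sigma^f$ with $\mu(B)>0$; $\mu$ is locally determined if it is semi-finite and $\Sigma=\{A\subset\Omega: A\cap B\in\Sigma\ \forall B\in\Sigma^f\}$. $L^0(\Sigma)$ denotes the $\Sigma$-measurable functions $\Omega\to\mathbb{K}$. Measurability and integrals of vector functions. A function $F$ with values in a Banach space is strongly $\mu$-measurable if it is the pointwise $\mu$-a.e. limit of a sequence of simple ($\Sigma$-measurable, finitely valued) functions whose supports have finite $\mu$-measure. $F:\Omega\to X$ is weakly $\mu$-measurable if $\langle F,x^*\rangle$ is strongly $\mu$-measurable for every $x^*\in X^*$. $F,G$ are weakly equal $\mu$-a.e. if $\langle F,x^*\rangle=\langle G,x^*\rangle$ $\mu$-a.e. for each $x^*\in X^*$ (null set depending on $x^*$). Functions that agree $\mu$-a.e. with $\Sigma$-measurable ones are integrated in the obvious way. $\mathbb{D}(\mu,X)$ (Dunford integrable functions) consists of the weakly $\mu$-measurable $F$, identified when weakly equal $\mu$-a.e., with $\langle F,x^*\rangle\in L^1(\mu)$ for all $x^*\in X^*$, normed by $\|F\|_{\mathbb{D}}=\sup_{x^*\in B_{X^*}}\int_\Omega|\langle F,x^*\rangle|\,d\mu$. $\mathbb{P}(\mu,X)$ (Pettis integrable functions) is the subspace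 of those $F\in\mathbb{D}(\mu,X)$ such that for each $A\in\Sigma$ there is $x_A\in X$ with $\int_A\langle F,x^*\rangle d\mu=\langle x_A,x^*\rangle$ for all $x^*\in X^*$; $x_A=:\mathbb{P}\text{-}\int_A F\,d\mu$; it carries the same norm, denoted $\|\cdot\|_{\mathbb{P}}$. $F$ is locally Pettis integrable if it is weakly $\mu$-measurable and $\chi_BF\in\mathbb{P}(\mu,X)$ for all $B\in\Sigma^f$; then for $B\in\Sigma^f$, $\mathbb{P}\text{-}\int_BF\,d\mu:=\mathbb{P}\text{-}\int_B\chi_BF\,d\mu$. Integration with respect to a vector measure. $\Sigma^f$ is a $\delta$-ring (a ring closed under countable intersections), and $\{A\subset\Omega: A\cap B\in\Sigma^f\ \forall B\in\Sigma^f\}=\Sigma$ as $\mu$ is locally determined. A vector measure $\nu:\Sigma^f\to X$ is a set function with $\nu(\bigcup_nB_n)=\sum_n\nu(B_n)$ for every pairwise disjoint sequence in $\Sigma^f$ with union in $\Sigma^f$; a scalar measure is the case $X=\mathbb{K}$. The variation of a scalar measure $\lambda$ on $\Sigma^f$ is the measure on $\Sigma$ given by $|\lambda|(A)=\sup\sum_j|\lambda(A_j)|$ over finite families of pairwise disjoint sets $A_j\in\Sigma^f$, $A_j\subset A$. $L^1(\lambda):=L^1(|\lambda|)$, and $\int f\,d\lambda$ is the continuous linear extension to $L^1(|\lambda|)$ of $\sum_ja_j\chi_{A_j}\mapsto\sum_ja_j\lambda(A_j)$ ($A_j\in\Sigma^f$); $\int_Af\,d\lambda=\int f\chi_A\,d\lambda$.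 For $x^*\in X^*$, $\langle\nu,x^*\rangle(B)=\langle\nu(B),x^*\rangle$. The semivariation is $\|\nu\|(A)=\sup_{x^*\in B_{X^*}}|\langle\nu,x^*\rangle|(A)$, $A\in\Sigma$; $A$ is $\nu$-null if $\|\nu\|(A)=0$, and functions in $L^0(\Sigma)$ are identified when equal outside a $\nu$-null set. $L^1_w(\nu)$ is the space of (classes of) $f\in L^0(\Sigma)$ with $f\in L^1(\langle\nu,x^*\rangle)$ for all $x^*\in X^*$, normed by $\|f\|_\nu=\sup_{x^*\in B_{X^*}}\int_\Omega|f|\,d|\langle\nu,x^*\rangle|$. $L^1(\nu)$ is the subspace of those $f\in L^1_w(\nu)$ such that for each $A\in\Sigma$ there is $x_A\in X$ with $\langle x_A,x^*\rangle=\int_Af\,d\langle\nu,x^*\rangle$ for all $x^*\in X^*$; $\int_Af\,d\nu:=x_A$; it carries the norm $\|\cdot\|_\nu$. ''Isometry'' means norm-preserving (not necessarily surjective). *)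

(* Defs.v *)
From HB Require Import structures.
From mathcomp Require Import all_boot all_order all_algebra.
From mathcomp Require Import complex.
From mathcomp Require Import all_classical all_reals all_analysis.

Set Implicit Arguments.
Unset Strict Implicit.
Unset Printing Implicit Defensive.

Import Order.TTheory GRing.Theory Num.Theory.
Import numFieldNormedType.Exports.

Local Open Scope classical_set_scope.
Local Open Scope ring_scope.

(* The scalar field is R or C = R[i]. Norms of normed spaces over it take values
   in the field itself; [kabs] brings moduli back to R. *)
Variant scalar_kind := RealScalars | ComplexScalars.

Definition scalar_field (R : realType) (k : scalar_kind) : numFieldType :=
  match k with RealScalars => R | ComplexScalars => R[i] end.

Definition kre (R : realType) (k : scalar_kind) : scalar_field R k -> R :=
  match k return scalar_field R k -> R with
  | RealScalars => fun z => z
  | ComplexScalars => fun z => complex.Re z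
  end.

Definition kim (R : realType) (k : scalar_kind) : scalar_field R k -> R :=
  match k return scalar_field R k -> R with
  | RealScalars => fun=> 0
  | ComplexScalars => fun z => complex.Im z
  end.

Definition kmk (R : realType) (k : scalar_kind) : R -> R -> scalar_field R k :=
  match k return R -> R -> scalar_field R k with
  | RealScalars => fun a _ => a
  | ComplexScalars => fun a b => (a +i* b)%C
  end.

Definition kabs (R : realType) (k : scalar_kind) (z : scalar_field R k) : R :=
  kre `|z|.

Record topdual (R : realType) (k : scalar_kind)
    (X : normedModType (scalar_field R k)) := TopDual {
  dual_fun :> {linear X -> (scalar_field R k)^o} ;
  dual_continuous : continuous dual_fun }.

Definition dual_ball (R : realType) (k : scalar_kind)
    (X : normedModType (scalar_field R k)) : set (topdual X) :=
  [set phi | forall x : X, `|x| <= 1 -> `|phi x| <= 1].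

Section MeasureSpace.
Context (R : realType) (k : scalar_kind).
Context (d : measure_display) (T : measurableType d).
Context (mu : {measure set T -> \bar R}).
Local Notation K := (scalar_field R k).

Definition finite_sets : set (set T) :=
  [set B | measurable B /\ (mu B < +oo)%E].

Definition semi_finite : Prop :=
  forall A, measurable A -> (0 < mu A)%E ->
    exists B, [/\ finite_sets B, B `<=` A & (0 < mu B)%E].

Definition locally_determined : Prop :=
  semi_finite /\
  measurable =
    [set A : set T | forall B, finite_sets B -> measurable (A `&` B)].

(* Measurability with respect to the Borel sets of the codomain; L^0(Sigma) is
   the case V = K^o. *)
Definition borel_fun (V : normedModType K) (f : T -> V) : Prop :=
  measurable_fun setT (f : T -> g_sigma_algebraType (@open V)).

Definition L0 (f : T -> K^o) : Prop := borel_fun f.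

Definition finite_support_simple (V : normedModType K) (s : T -> V) : Prop :=
  [/\ borel_fun s, finite_set (range s) & (mu [set x | (s x != 0)%R] < +oo)%E].

Definition strongly_measurable (V : normedModType K) (f : T -> V) : Prop :=
  exists s : nat -> T -> V,
    (forall n, finite_support_simple (s n)) /\
    {ae mu, forall x, s n x @[n --> \oo] --> f x}.

(* A measurable function equal mu-a.e. to f, if there is one: mu need not be
   complete, so a strongly measurable f is integrated through [mrep f]. *)
Definition mrep (f : T -> K^o) : T -> K^o :=
  xget (cst 0) [set h : T -> K^o | L0 h /\ {ae mu, forall x, f x = h x}].

(* Membership in L^1(m); m is a set function so that variations are covered. *)
Definition L1fun (m : set T -> \bar R) (f : T -> K^o) : Prop :=
  L0 f /\ (\int[m]_x (kabs (f x))%:E < +oo)%E.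

Definition kintegral (A : set T) (f : T -> K^o) : K :=
  kmk k (Rintegral mu A (fun x => kre (mrep f x)))
        (Rintegral mu A (fun x => kim (mrep f x))).

Section VectorFunctions.
Context (X : normedModType K).

Definition weakly_measurable (F : T -> X) : Prop :=
  forall phi : topdual X, strongly_measurable (phi \o F).

Definition weakly_ae_eq (F G : T -> X) : Prop :=
  forall phi : topdual X, {ae mu, forall x, phi (F x) = phi (G x)}.

Definition dunford (F : T -> X) : Prop :=
  weakly_measurable F /\ forall phi : topdual X, L1fun mu (mrep (phi \o F)).

Definition dunford_norm (F : T -> X) : \bar R :=
  ereal_sup [set (\int[mu]_x (kabs (mrep (phi \o F) x))%:E)%E
            | phi in @dual_ball R k X].

Definition is_pettis_integral (F : T -> X) (A : set T) (x : X) : Prop :=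
  forall phi : topdual X, kintegral A (phi \o F) = phi x.

Definition pettis (F : T -> X) : Prop :=
  dunford F /\ forall A, measurable A -> exists x, is_pettis_integral F A x.

Definition pettis_integral (A : set T) (F : T -> X) : X :=
  xget 0 [set x | is_pettis_integral F A x].

Definition locally_pettis (F : T -> X) : Prop :=
  weakly_measurable F /\
  forall B, finite_sets B -> pettis (fun x => (\1_B x : K) *: F x).

(* nu_F; only its values on sets of finite measure are meaningful. *)
Definition pettis_measure (F : T -> X) (B : set T) : X :=
  pettis_integral B (fun x => (\1_B x : K) *: F x).

End VectorFunctions.

(* Set functions on the delta-ring of sets of finite measure are represented by
   total functions on sets; only their values on that delta-ring are used. *)

Definition scalar_variation (lam : set T -> K^o) (A : set T) : \bar R :=
  ereal_sup [set v | exists n (B : 'I_n -> set T),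
    [/\ forall i, finite_sets (B i) /\ B i `<=` A,
        trivIset setT B &
        v = (\sum_(i < n) kabs (lam (B i)))%:E]].

(* I restricts to a continuous linear functional on L^1(|lam|) sending the
   indicator of each set A of finite measure to lam A. *)
Definition is_scalar_integral (lam : set T -> K^o) (I : (T -> K^o) -> K)
    : Prop :=
  [/\ forall (a : K) f g,
        L1fun (scalar_variation lam) f -> L1fun (scalar_variation lam) g ->
        I (fun x => a * f x + g x) = a * I f + I g,
      exists C : R, forall f, L1fun (scalar_variation lam) f ->
        ((kabs (I f))%:E <=
           C%:E * \int[scalar_variation lam]_x (kabs (f x))%:E)%E &
      forall A, finite_sets A -> I \1_A = lam A].

Definition scalar_integral (lam : set T -> K^o) : (T -> K^o) -> K :=
  xget (fun=> 0) [set I | is_scalar_integral lam I].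

Definition scalar_integral_on (lam : set T -> K^o) (A : set T) (f : T -> K^o)
    : K := scalar_integral lam (fun x => f x * \1_A x).

Section VectorMeasure.
Context (X : normedModType K) (nu : set T -> X).

Definition scalarize (phi : topdual X) (B : set T) : K^o := phi (nu B).

Definition semivariation (A : set T) : \bar R :=
  ereal_sup [set scalar_variation (scalarize phi) A | phi in @dual_ball R k X].

Definition vm_null (N : set T) : Prop := measurable N /\ semivariation N = 0%E.

Definition vm_ae_eq (f g : T -> K^o) : Prop :=
  exists2 N, vm_null N & forall x, ~ N x -> f x = g x.

Definition L1w (f : T -> K^o) : Prop :=
  L0 f /\ forall phi : topdual X, L1fun (scalar_variation (scalarize phi)) f.

Definition L1w_norm (f : T -> K^o) : \bar R :=
  ereal_sup [set (\int[scalar_variation (scalarize phi)]_x (kabs (f x))%:E)%E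
            | phi in @dual_ball R k X].

Definition is_vm_integral (f : T -> K^o) (A : set T) (x : X) : Prop :=
  forall phi : topdual X, phi x = scalar_integral_on (scalarize phi) A f.

Definition L1vm (f : T -> K^o) : Prop :=
  L1w f /\ forall A, measurable A -> exists x, is_vm_integral f A x.

Definition vm_integral (A : set T) (f : T -> K^o) : X :=
  xget 0 [set x | is_vm_integral f A x].

End VectorMeasure.
End MeasureSpace.

(* A space of classes is given by its representatives, the identification made
   between them and the norm of a class computed on a representative. *)
Record class_space (R : realType) (U : Type) := ClassSpace {
  cs_mem : U -> Prop ;
  cs_eq : U -> U -> Prop ;
  cs_norm : U -> \bar R }.

(* M, given on representatives, induces a map on classes that is linear and
   norm preserving. *)
Definition linear_isometry (R : realType) (k : scalar_kind)
    (U V : lmodType (scalar_field R k))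
    (S : class_space R U) (S' : class_space R V) (M : U -> V) : Prop :=
  [/\ forall u, cs_mem S u -> cs_mem S' (M u),
      forall u v, cs_mem S u -> cs_mem S v -> cs_eq S u v ->
        cs_eq S' (M u) (M v),
      forall (a : scalar_field R k) u v, cs_mem S u -> cs_mem S v ->
        cs_eq S' (M (a *: u + v)) (a *: M u + M v) &
      forall u, cs_mem S u -> cs_norm S' (M u) = cs_norm S u].

Section Spaces.
Context (R : realType) (k : scalar_kind).
Context (d : measure_display) (T : measurableType d).
Context (mu : {measure set T -> \bar R}).
Context (X : normedModType (scalar_field R k)).
Local Notation K := (scalar_field R k).

Definition Dunford_space : class_space R (T -> X) :=
  ClassSpace (dunford mu (X := X)) (weakly_ae_eq mu (X := X))
    (dunford_norm mu (X := X)).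

Definition Pettis_space : class_space R (T -> X) :=
  ClassSpace (pettis mu (X := X)) (weakly_ae_eq mu (X := X))
    (dunford_norm mu (X := X)).

Definition L1w_space (nu : set T -> X) : class_space R (T -> K^o) :=
  ClassSpace (L1w mu nu) (vm_ae_eq mu nu) (L1w_norm mu nu).

Definition L1_space (nu : set T -> X) : class_space R (T -> K^o) :=
  ClassSpace (L1vm mu nu) (vm_ae_eq mu nu) (L1w_norm mu nu).

Definition mult_map (F : T -> X) (g : T -> K^o) : T -> X :=
  fun x => (g x : K) *: F x.

End Spaces.

(* Main.v *)
Require Import Defs.
From HB Require Import structures.
From mathcomp Require Import all_boot all_order all_algebra.
From mathcomp Require Import complex.
From mathcomp Require Import all_classical all_reals all_analysis.
From mathcomp Require Import measurable_realfun ring lra.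
Import Order.TTheory GRing.Theory Num.Theory.
Import numFieldNormedType.Exports HBNNSimple.
Local Open Scope classical_set_scope.
Local Open Scope ring_scope.
Set Implicit Arguments.
Unset Strict Implicit.
Unset Printing Implicit Defensive.

(** Fix a functional [phi] of the dual. Since [phi \o F] is strongly measurable,
    it agrees a.e. with a measurable function [h] that vanishes outside a
    countable union of sets of finite measure, and local Pettis integrability
    says that [h] is integrable over each set of finite measure, with
    [phi (nu_F B)] equal to the integral of [h] over [B]. So the scalar measure
    [phi \o nu_F] is [h] times [mu]. Two facts about such a measure give the
    theorem.

    First, its variation is [kabs h] times [mu] ([variation_kint]). Only the
    lower bound is not immediate: a finite partition that nearly attains the
    variation is obtained from the level sets of a simple function close to [h]
    in [L^1], first on a set of finite measure and then, by monotone convergence,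
    on the whole support. Hence the integral of [kabs g] against the variation is
    the integral of [kabs (g * h)] against [mu]
    ([integral_variation_mult_map]). As [g * h] is a version of
    [phi \o (g *: F)], this is the equivalence between membership of [g] in
    [L^1_w] and Dunford integrability of [g *: F]; taking the supremum over the
    unit ball of the dual gives the equality of the norms. That the map is well
    defined on classes follows too: on a set of semivariation zero, [h] vanishes
    a.e. ([vm_null_density]).

    Second, the integral of [g] against [phi \o nu_F] is the integral of [g * h]
    against [mu] ([scalar_integral_onE]): the latter has the properties that
    characterize the former, and these determine it since simple functions with
    supports of finite measure are dense. So a vector [y] is the integral of [g]
    over [A] against [nu_F] exactly when it is the Pettis integral of [g *: F]
    over [A] ([vm_integral_mult_map]), which gives both the equivalence for
    [L^1] and the identity of the two integration operators.

    Scalars are treated through the coordinates [kre], [kim] and the modulus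
    [kabs], so that the real and the complex case are one. *)

(** * Coordinates of scalars *)

Section Scalars.
Context {R : realType} {k : scalar_kind}.
Local Notation K := (scalar_field R k).
Implicit Types z w : K.

Lemma kext z w : kre z = kre w -> kim z = kim w -> z = w.
Proof.
case: k z w => [z w //|[a b] [a' b']] /=.
by move=> -> ->.
Qed.

Lemma kreD z w : kre (z + w) = kre z + kre w.
Proof. by case: k z w => // -[a b] [c e]. Qed.

Lemma kimD z w : kim (z + w) = kim z + kim w.
Proof. by case: k z w => [z w|[a b] [c e] //] /=; rewrite addr0. Qed.

Lemma kre0 : kre (0 : K) = 0.
Proof. by case: k. Qed.

Lemma kim0 : kim (0 : K) = 0.
Proof. by case: k. Qed.

Lemma kreM z w : kre (z * w) = kre z * kre w - kim z * kim w.
Proof. by case: k z w => [z w|[a b] [c e] //] /=; rewrite mulr0 subr0. Qed.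

Lemma kimM z w : kim (z * w) = kre z * kim w + kim z * kre w.
Proof. by case: k z w => [z w|[a b] [c e] //] /=; rewrite mulr0 mul0r addr0. Qed.

Lemma kre1 : kre (1 : K) = 1.
Proof. by case: k. Qed.

Lemma kim1 : kim (1 : K) = 0.
Proof. by case: k. Qed.

Lemma kreN z : kre (- z) = - kre z.
Proof. by apply/eqP; rewrite -addr_eq0 -kreD addNr kre0. Qed.

Lemma kimN z : kim (- z) = - kim z.
Proof. by apply/eqP; rewrite -addr_eq0 -kimD addNr kim0. Qed.

Lemma kre_mk (a b : R) : kre (kmk k a b) = a.
Proof. by case: k. Qed.

Lemma kim_real z : k = RealScalars -> kim z = 0.
Proof. by case: k z. Qed.

(** For real scalars [kmk] drops its second argument, which is harmless exactly
    when that argument vanishes. *)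
Lemma kim_mk (a b : R) : (k = RealScalars -> b = 0) -> kim (kmk k a b) = b.
Proof. by case: k => //= /(_ erefl). Qed.

Lemma kabsE z : kabs z = Num.sqrt (kre z ^+ 2 + kim z ^+ 2).
Proof.
case: k z => [z|[a b]] /=; first by rewrite /kabs /= expr0n addr0 sqrtr_sqr.
exact: (congr1 (@complex.Re R) (normc_def (a +i* b)%C)).
Qed.

Lemma normr_kmk z : `|z| = kmk k (kabs z) 0.
Proof. 
case: k z => [z //|[a b]].
by rewrite /kabs; have /= -> := normc_def (a +i* b)%C.
Qed.

Lemma normr_lt_kmk z (e : R) : (`|z| < kmk k e 0) = (kabs z < e).
Proof.
rewrite normr_kmk; move: (kabs z) => c; case: k => //=.
by rewrite ltcE /= eqxx.
Qed.

Lemma kmk_gt0 (e : R) : (0 < kmk k e 0) = (0 < e).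
Proof. by case: k => //=; rewrite ltcE /= eqxx. Qed.

Lemma gt0_kmk z : 0 < z -> z = kmk k (kre z) 0.
Proof. by case: k z => //= -[a b]; rewrite ltcE /= => /andP[/eqP->]. Qed.

Lemma kabs_ge0 z : 0 <= kabs z.
Proof. by rewrite kabsE. Qed.

Lemma kabsM z w : kabs (z * w) = kabs z * kabs w.
Proof.
rewrite !kabsE kreM kimM -sqrtrM ?addr_ge0 ?sqr_ge0//.
by congr Num.sqrt; ring.
Qed.

Lemma kabsN z : kabs (- z) = kabs z.
Proof. by rewrite /kabs normrN. Qed.

Lemma kabsD z w : kabs (z + w) <= kabs z + kabs w.
Proof.
have := ler_normD z w; rewrite !normr_kmk.
move: (kabs _) (kabs z) (kabs w) => a b c; case: k => //=.
by rewrite lecE /= => /andP[].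
Qed.

Lemma kabs0 : kabs (0 : K) = 0.
Proof. by rewrite kabsE kre0 kim0 expr0n addr0 sqrtr0. Qed.

Lemma kabs0_eq0 z : kabs z = 0 -> z = 0.
Proof.
move=> z0; apply/eqP; rewrite -normr_eq0 normr_kmk z0.
by apply/eqP/kext; rewrite ?kre_mk ?kre0//; case: k.
Qed.

Lemma kabs_eq0 z : (kabs z == 0) = (z == 0).
Proof. by apply/eqP/eqP => [/kabs0_eq0|->]; rewrite ?kabs0. Qed.

Lemma kre_le z : `|kre z| <= kabs z.
Proof. by rewrite kabsE -sqrtr_sqr ler_wsqrtr// lerDl sqr_ge0. Qed.

Lemma kim_le z : `|kim z| <= kabs z.
Proof. by rewrite kabsE -sqrtr_sqr ler_wsqrtr// lerDr sqr_ge0. Qed.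

Lemma kabs_le z : kabs z <= `|kre z| + `|kim z|.
Proof.
rewrite kabsE -(@ler_sqr _ (Num.sqrt _)) ?nnegrE ?addr_ge0//.
rewrite sqr_sqrtr ?addr_ge0 ?sqr_ge0// sqrrD !real_normK ?num_real//.
by rewrite addrAC lerDl mulrn_wge0 ?mulr_ge0.
Qed.

(** Cauchy-Schwarz in the plane: the difference of the squares of the two sides
    is itself a square. *)
Lemma kre_kim_dot z w : kre z * kre w + kim z * kim w <= kabs z * kabs w.
Proof.
rewrite -kabsM kabsE kreM kimM.
apply: le_trans (ler_norm _) _; rewrite -sqrtr_sqr ler_wsqrtr//.
rewrite -subr_ge0.
rewrite [leRHS](_ : _ = (kre z * kim w - kim z * kre w) ^+ 2) ?sqr_ge0//.
by ring.
Qed.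

Lemma kabs_sqr z : kabs z ^+ 2 = kre z ^+ 2 + kim z ^+ 2.
Proof. by rewrite kabsE sqr_sqrtr// addr_ge0 ?sqr_ge0. Qed.

(** The norm of [K^o] takes its values in [K], hence so do the radii of its
    balls; real radii give the same neighbourhoods because a positive scalar is
    real. *)
Lemma nbhs_kabsP (z : K^o) (A : set K^o) :
  nbhs z A <-> exists2 e : R, 0 < e & forall w : K^o, kabs (z - w : K) < e -> A w.
Proof.
apply: iff_trans (nbhs_normP z A) _; split => [[e /= e0 zA]|[e e0 zA]].
  have ee := gt0_kmk e0.
  exists (kre e); first by rewrite -kmk_gt0 -ee.
  by move=> w zw; apply: zA => /=; rewrite ee; rewrite normr_lt_kmk.
exists (kmk k e 0); first by rewrite /= kmk_gt0.
by move=> w /=; rewrite normr_lt_kmk => /zA.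
Qed.

Lemma cvg_kabsP (u : nat -> K^o) (z : K^o) :
  u n @[n --> \oo] --> z <->
  (fun n => kabs (u n - z : K)) n @[n --> \oo] --> (0 : R).
Proof.
split => [uz|uz A].
  apply/cvgrPdist_lt => e e0; have /uz : nbhs z [set w | kabs (w - z : K) < e].
    by apply/nbhs_kabsP; exists e => // w /=; rewrite -kabsN opprB.
  apply: (@filterS _ \oo) => n /=; rewrite sub0r normrN ger0_norm ?kabs_ge0//.
move=> zA0; have /nbhs_kabsP[e e0 zA] : nbhs z A by [].
have /cvgrPdist_lt/(_ _ e0) := uz.
apply: (@filterS _ \oo) => n /=; rewrite sub0r normrN ger0_norm ?kabs_ge0// => un.
by apply: zA; rewrite -kabsN opprB.
Qed.

End Scalars.

(** * Measurability of scalar functions *)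

Section Measurability.
Context {R : realType} {k : scalar_kind}.
Local Notation K := (scalar_field R k).
Context {d : measure_display} {T : measurableType d}.
Implicit Types f g : T -> K^o.

Local Notation re f := (fun x => kre (f x : K)).
Local Notation im f := (fun x => kim (f x : K)).

(** Any function of a scalar that is 1-Lipschitz for the modulus is continuous,
    so the sets where it exceeds a constant are open. Both coordinates and the
    modulus are of this kind. *)
Lemma L0_halfspace (c : K^o -> R) f :
  (forall z w : K^o, `|c z - c w| <= kabs (z - w : K)) ->
  L0 f -> measurable_fun setT (c \o f).
Proof.
move=> c1 mf; apply: (measurability (@RGenOInfty.G R)).
  exact: RGenOInfty.measurableE.
move=> _ [_ [a ->] <-]; rewrite comp_preimage; apply: mf => //.
apply: sub_sigma_algebra; rewrite openE => z /=.
rewrite in_itv/= andbT => az; apply/nbhs_kabsP; exists (c z - a).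
  by rewrite subr_gt0.
move=> w zw /=; rewrite in_itv/= andbT.
have := le_lt_trans (le_trans (ler_norm _) (c1 z w)) zw; lra.
Qed.

(** An open set is the union of the rational squares it contains. There are
    countably many of these, which is why the measurability of the two
    coordinates suffices. *)
Lemma L0P f : L0 f <-> measurable_fun setT (re f) /\ measurable_fun setT (im f).
Proof.
split=> [mf|[mr mi]].
  split; apply: (L0_halfspace (c := _)) mf => z w.
    by rewrite -kreN -kreD kre_le.
  by rewrite -kimN -kimD kim_le.
apply: (@measurability _ _ T (g_sigma_algebraType (@open K^o)) setT f (@open K^o)) => //.
move=> _ [U oU <-]; rewrite setTI.
pose box (q : rat * rat * nat) : set T :=
  [set x | `|kre (f x : K) - ratr q.1.1| < q.2.+1%:R^-1] `&`
  [set x | `|kim (f x : K) - ratr q.1.2| < q.2.+1%:R^-1].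
pose good (q : rat * rat * nat) := forall z : K^o,
  `|kre (z : K) - ratr q.1.1| < q.2.+1%:R^-1 ->
  `|kim (z : K) - ratr q.1.2| < q.2.+1%:R^-1 -> U z.
have -> : f @^-1` U = \bigcup_q (if `[< good q >] then box q else set0).
  apply/seteqP; split=> x /=; last first.
    move=> [q _]; case: asboolP => // gq [/= h1 h2]; exact: gq.
  move=> Ufx; have /nbhs_kabsP[e e0 eU] : nbhs (f x) U.
    by apply: open_nbhs_nbhs.
  have [n ne] : exists n, n.+1%:R^-1 < e / 4.
    have e4 : 0 < e / 4 by lra.
    have /cvgrPdist_lt/(_ _ e4) [n _ /(_ n (leqnn n))] := @cvg_harmonic R.
    by rewrite /= sub0r normrN ger0_norm ?invr_ge0// => ?; exists n.
  have n0 : 0 < n.+1%:R^-1 :> R by rewrite invr_gt0.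
  have tri (a b c h : R) : `|a - c| < h -> `|b - c| < h -> `|a - b| < 2 * h.
    rewrite !ltr_norml => /andP[? ?] /andP[? ?]; apply/andP; split; lra.
  have rat_close (r h : R) : 0 < h -> exists q : rat, `|r - ratr q| < h.
    move=> h0; have [q] : exists q : rat, ratr q \in `]r - h, r + h[.
      by apply: rat_in_itvoo; lra.
    rewrite in_itv/= => /andP[? ?]; exists q.
    by rewrite ltr_norml; apply/andP; split; lra.
  have [q1 Hq1] := rat_close (kre (f x : K)) _ n0.
  have [q2 Hq2] := rat_close (kim (f x : K)) _ n0.
  exists (q1, q2, n) => //; case: asboolP => // -[] z /= z1 z2.
  apply: eU; apply: le_lt_trans (kabs_le _) _.
  rewrite kreD kimD kreN kimN.
  have := tri _ _ _ _ Hq1 z1; have := tri _ _ _ _ Hq2 z2.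
  move: ne; move: (n.+1%:R^-1) => h; lra.
apply: countable_bigcupT_measurable; first exact: countableP.
move=> q; case: asboolP => // _; rewrite /box.
have mball (h : T -> R) (a e : R) :
    measurable_fun setT h -> measurable [set x | `|h x - a| < e].
  move=> mh.
  have -> : [set x | `|h x - a| < e] = setT `&` h @^-1` `]a - e, a + e[%classic.
    apply/seteqP; split => x /=; rewrite in_itv/= ltr_norml ?setTI.
      by move=> /andP[? ?]; split => //; apply/andP; split; lra.
    by move=> [_ /andP[? ?]]; apply/andP; split; lra.
  by apply: mh.
by apply: measurableI; exact: mball.
Qed.

Lemma L0_re f : L0 f -> measurable_fun setT (re f).
Proof. by move=> /L0P[]. Qed.

Lemma L0_im f : L0 f -> measurable_fun setT (im f).
Proof. by move=> /L0P[]. Qed.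

Lemma L0_cst (c : K^o) : L0 (fun _ : T => c).
Proof. by apply/L0P; split; exact: measurable_cst. Qed.

Lemma L0D f g : L0 f -> L0 g -> L0 (fun x => f x + g x).
Proof.
move=> /L0P[? ?] /L0P[? ?]; apply/L0P; split.
  under eq_fun do rewrite kreD; exact: measurable_funD.
under eq_fun do rewrite kimD; exact: measurable_funD.
Qed.

Lemma L0M f g : L0 f -> L0 g -> L0 (fun x => (f x : K) * g x).
Proof.
move=> /L0P[? ?] /L0P[? ?]; apply/L0P; split.
  under eq_fun do rewrite kreM.
  by apply: measurable_funB; exact: measurable_funM.
under eq_fun do rewrite kimM.
by apply: measurable_funD; exact: measurable_funM.
Qed.

Lemma L0_indic (A : set T) : measurable A -> L0 (\1_A : T -> K^o).
Proof.
move=> mA; apply/L0P; split.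
  have -> : re (\1_A : T -> K^o) = (\1_A : T -> R).
    apply/funext => x; rewrite !indicE; case: (x \in A) => /=.
      exact: kre1.
    exact: kre0.
  exact: measurable_indic.
have -> : im (\1_A : T -> K^o) = cst 0.
  apply/funext => x; rewrite !indicE; case: (x \in A) => /=.
    exact: kim1.
  exact: kim0.
exact: measurable_cst.
Qed.

Lemma L0_kabs f : L0 f -> measurable_fun setT (fun x => kabs (f x : K)).
Proof.
apply: (L0_halfspace (c := fun z => kabs (z : K))) => z w /=.
have := kabsD (z - w : K) w; have := kabsD (w - z : K) z.
rewrite !subrK -opprB kabsN ler_norml => ? ?; apply/andP; split; lra.
Qed.

Lemma L0_limit (u : nat -> T -> K^o) f : (forall n, L0 (u n)) ->
  (forall x, u n x @[n --> \oo] --> f x) -> L0 f.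
Proof.
move=> mu_ uf; apply/L0P.
have coord (c : K^o -> R) : (forall n, measurable_fun setT (c \o u n)) ->
  (forall z w : K^o, `|c z - c w| <= kabs (z - w : K)) ->
  measurable_fun setT (c \o f).
  move=> mc c1; apply: (measurable_fun_cvg (h := fun n => c \o u n)) => // x _.
  apply/cvgrPdist_lt => e e0.
  have /cvg_kabsP/cvgrPdist_lt/(_ _ e0) := uf x.
  apply: (@filterS _ \oo) => n /=; rewrite sub0r normrN ger0_norm ?kabs_ge0//.
  by apply: le_lt_trans; rewrite distrC.
split; apply: (coord (fun z => _ z)) => [n|z w].
- exact: L0_re.
- by rewrite -kreN -kreD kre_le.
- exact: L0_im.
- by rewrite -kimN -kimD kim_le.
Qed.

End Measurability.

(** * Simple approximation and strong measurability *)

Section RealApprox.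
Context {R : realType} {d : measure_display} {T : measurableType d}.

(** The positive and the negative part are approximated from below; as they are
    not both nonzero at a point, the difference of the approximations is
    dominated by the function. *)
Lemma real_simple_approx (f : T -> R) : measurable_fun setT f ->
  exists s : nat -> T -> R,
    [/\ forall n, measurable_fun setT (s n),
        forall n, finite_set (range (s n)),
        forall n x, `|s n x| <= `|f x| &
        forall x, s n x @[n --> \oo] --> f x].
Proof.
move=> mf.
have pos_approx (g : T -> R) : measurable_fun setT g -> (forall x, 0 <= g x) ->
  exists s : nat -> T -> R, [/\ forall n, measurable_fun setT (s n),
        forall n, finite_set (range (s n)),
        forall n x, 0 <= s n x <= g x &
        forall x, s n x @[n --> \oo] --> g x].
  move=> mg g0; have mEg : measurable_fun setT (EFin \o g).
    exact/measurable_EFinP.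
  have Eg0 x : [set: T] x -> (0 <= (EFin \o g) x)%E by rewrite /= lee_fin.
  exists (fun n x => nnsfun_approx measurableT mEg n x); split => [n|n|n x|x].
  - exact: measurable_funPT.
  - exact: fimfunP.
  - by rewrite fun_ge0 nnsfun_approxE /= -lee_fin (le_approx _ Eg0).
  - under eq_cvg do rewrite nnsfun_approxE.
    by apply: (cvg_approx Eg0) => //=; rewrite ltry.
have [a [ma fa a_le ca]] := pos_approx _ (measurable_funrpos mf) (funrpos_ge0 f).
have [b [mb fb b_le cb]] := pos_approx _ (measurable_funrneg mf) (funrneg_ge0 f).
exists (fun n x => a n x - b n x); split => [n|n|n x|x].
- exact: measurable_funB.
- exact: (finite_image11 (fun a b : R => a - b)).
- have := a_le n x; have := b_le n x; rewrite /funrpos/funrneg.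
  by case: (leP 0 (f x)) => f0; rewrite ?(ger0_norm f0) ?(ltr0_norm f0)
    /Num.max; case: ltP => ?; case: ltP => ?;
    move=> /andP[? ?] /andP[? ?]; rewrite ler_norml; apply/andP; split; lra.
- have -> : f x = f^\+ x - f^\- x by rewrite -[in LHS](funrposBneg f).
  by apply: cvgB.
Qed.

End RealApprox.

Section StrongMeasurability.
Context {R : realType} {k : scalar_kind}.
Local Notation K := (scalar_field R k).
Context {d : measure_display} {T : measurableType d}.
Context (mu : {measure set T -> \bar R}).
Implicit Types f g h : T -> K^o.

(** Both coordinates are approximated separately, which costs the factor [2]. The
    domination is what makes dominated convergence available later on. *)
Lemma L0_simple_approx f : L0 f ->
  exists s : nat -> T -> K^o,
    [/\ forall n, L0 (s n),
        forall n, finite_set (range (s n)),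
        forall n x, kabs (s n x : K) <= 2 * kabs (f x : K) &
        forall x, s n x @[n --> \oo] --> f x].
Proof.
move=> /L0P[/real_simple_approx[a [ma fa al ca]]
            /real_simple_approx[b [mb fb bl cb]]].
pose s n x : K^o := kmk k (a n x) (b n x).
have re_s n x : kre (s n x : K) = a n x by rewrite kre_mk.
have im_s n x : kim (s n x : K) = b n x.
  rewrite kim_mk// => kR; apply/eqP; rewrite -normr_le0.
  by rewrite (le_trans (bl n x))// kim_real// normr0.
exists s; split => [n|n|n x|x].
- by apply/L0P; split; [rewrite (funext (re_s n))|rewrite (funext (im_s n))].
- exact: (finite_image11 (kmk k)).
- apply: le_trans (kabs_le _) _; rewrite re_s im_s.
  have := al n x; have := bl n x.
  have := kre_le (f x : K); have := kim_le (f x : K); lra.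
- apply/cvg_kabsP; apply: (@squeeze_cvgr _ _ _ _ (fun=> 0)
    (fun n => `|a n x - kre (f x : K)| + `|b n x - kim (f x : K)|)).
  + apply: nearW => n; rewrite kabs_ge0 (le_trans (kabs_le _))//.
    by rewrite kreD kimD kreN kimN re_s im_s.
  + exact: cvg_cst.
  + rewrite -[X in _ --> X](addr0 0) -{1}(normr0 R) -{2}(normr0 R).
    apply: cvgD; apply: cvg_norm; apply/cvgr0Pnorm_lt => e e0.
    * have /cvgrPdist_lt/(_ _ e0) := ca x; apply: filterS => n.
      by rewrite distrC.
    * have /cvgrPdist_lt/(_ _ e0) := cb x; apply: filterS => n.
      by rewrite distrC.
Qed.

(** Strong measurability makes supports sigma-finite although [mu] need not be
    so. The sets increase so that integrals over them converge monotonically. *)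
Definition exhausts (E : nat -> set T) h :=
  [/\ forall n, finite_sets mu (E n),
      {homo E : n m / (n <= m)%N >-> (n <= m)%O} &
      forall x, h x <> 0 -> exists n, E n x].

Lemma L0_neq0 h : L0 h -> measurable [set x | (h x != 0)%R].
Proof.
move=> /L0_kabs mh.
rewrite (_ : mkset _ = setT `&` (fun x => kabs (h x : K)) @^-1` ~` [set 0]).
  by apply: mh => //; apply: measurableC.
rewrite setTI; apply/seteqP; split => x /=; rewrite -(kabs_eq0 (h x : K)).
  by move=> /eqP.
by move=> /eqP.
Qed.

Lemma finite_setsU (A B : set T) :
  finite_sets mu A -> finite_sets mu B -> finite_sets mu (A `|` B).
Proof.
move=> [mA fA] [mB fB]; split; first exact: measurableU.
by apply: le_lt_trans (measureU2 _ _ _) _ => //; rewrite lte_add_pinfty.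
Qed.

Lemma finite_setsS (A B : set T) :
  finite_sets mu A -> measurable B -> B `<=` A -> finite_sets mu B.
Proof.
move=> [mA fA] mB BA; split => //; apply: le_lt_trans fA.
by apply: le_measure; rewrite ?inE.
Qed.

Lemma exhausts_simple_support (s : nat -> T -> K^o) f :
  (forall n, finite_support_simple mu (s n)) ->
  (forall x, f x <> 0 -> exists n, s n x != 0) ->
  exists E, exhausts E f.
Proof.
move=> ss fs.
pose E n := \big[setU/set0]_(i < n) [set x | s i x != 0].
exists E; split => [n|n m nm|x /fs[n sn]].
- rewrite /E; apply: big_ind.
  + by split => //; rewrite measure0.
  + exact: finite_setsU.
  + by move=> i _; have [/L0_neq0 ? _ ?] := ss i; split.
- apply/subsetPset.
  exact: (@subset_bigsetU _ (fun i => [set x | (s i x != 0)%R]) _ _ nm).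
- by exists n.+1; rewrite /E big_ord_recr /=; right.
Qed.

Lemma indic_mulE (A : set T) h x : (h x : K) * (\1_A x : K^o) =
  if x \in A then h x else 0.
Proof. by rewrite indicE; case: (x \in A); rewrite ?mulr1 ?mulr0. Qed.

(** Off a measurable null set the limit of the simple functions is measurable,
    and it vanishes outside the union of their supports. Conversely, simple
    approximations of [h] can be cut off along the exhaustion. *)
Lemma strongly_measurableP f : strongly_measurable mu f <->
  exists h E, [/\ L0 h, exhausts E h & {ae mu, forall x, f x = h x}].
Proof.
split => [[s [ss [N [mN N0 NP]]]]|[h [E [Lh [fE ndE Eh] fh]]]].
  pose h x : K^o := (f x : K) * (\1_(~` N) x : K^o).
  have sf x : ~ N x -> s n x @[n --> \oo] --> f x.
    by move=> Nx; apply: contrapT => /NP.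
  have Lh : L0 h.
    apply: (@L0_limit _ _ _ _ (fun n x => (s n x : K) * (\1_(~` N) x : K^o))).
      move=> n; apply: L0M; first by have [] := ss n.
      by apply: L0_indic; apply: measurableC.
    move=> x; rewrite /h indic_mulE; under eq_cvg do rewrite indic_mulE.
    case: ifPn => [/set_mem/= Nx|_]; last exact: cvg_cst.
    exact: sf.
  have [E ?] : exists E, exhausts E h.
    apply: (@exhausts_simple_support s) => // x; rewrite /h indic_mulE.
    case: ifPn => // /set_mem/= Nx fx0; apply: contrapT => s0; apply: fx0.
    have /cvg_lim <- // := sf x Nx.
    rewrite (_ : (fun n => s n x) = cst 0) ?lim_cst//.
    apply/funext => n; apply/eqP/negPn/negP => sn; apply: s0; by exists n.
  exists h, E; split => //.
  exists N; split => // x /= fhx; apply: contrapT => Nx; apply: fhx.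
  by rewrite /h indic_mulE mem_set.
have [s [Ls fs sl sc]] := L0_simple_approx Lh.
exists (fun n x => (s n x : K) * (\1_(E n) x : K^o)); split => [n|].
  split.
  - by apply: L0M => //; apply: L0_indic; have [] := fE n.
  - apply: (finite_image11 (fun a b : K^o => (a : K) * b) (fs n)).
    apply: (@sub_finite_set _ _ [set (0 : K^o); 1]); last exact: finite_set2.
    by move=> _ [x _ <-]; rewrite indicE; case: (x \in E n); [right|left].
  - apply: le_lt_trans (fE n).2; apply: le_measure; rewrite ?inE.
    + apply: L0_neq0; apply: L0M => //; apply: L0_indic; have [] := fE n; by [].
    + by have [] := fE n.
    + move=> x /=; rewrite indic_mulE; case: ifPn => [/set_mem//|_].
      by rewrite eqxx.
apply: filterS fh => x ->.
have [hx|/Eh[m Em]] := pselect (h x = 0).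
  rewrite hx (_ : (fun n => _) = cst 0); first exact: cvg_cst.
  apply/funext => n; have := sl n x.
  rewrite hx kabs0 mulr0 => sn; rewrite (_ : s n x = 0) ?mul0r//.
  by apply: kabs0_eq0; apply/eqP; rewrite eq_le sn kabs_ge0.
apply: cvg_trans (sc x); apply: near_eq_cvg; exists m => // n /= mn.
rewrite indic_mulE mem_set//.
by have /subsetPset := ndE _ _ mn; exact.
Qed.

End StrongMeasurability.

(** * Integrals of scalar functions *)

Section ScalarIntegral.
Context {R : realType} {k : scalar_kind}.
Local Notation K := (scalar_field R k).
Context {d : measure_display} {T : measurableType d}.
Context (mu : {measure set T -> \bar R}).
Implicit Types (f g : T -> K^o) (A B : set T).

Definition kint A f : K :=
  kmk k (Rintegral mu A (fun x => kre (f x : K)))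
        (Rintegral mu A (fun x => kim (f x : K))).

Definition kintegrable A f :=
  L0 f /\ mu.-integrable A (EFin \o (fun x => kabs (f x : K))).

Definition kint_norm A f : R := Rintegral mu A (fun x => kabs (f x : K)).

Lemma integrableZ_real A (c : R) (u : T -> R) : measurable A ->
  mu.-integrable A (EFin \o u) -> mu.-integrable A (EFin \o (fun x => c * u x)).
Proof.
move=> mA ui; apply: (eq_integrable mA (fun x => c%:E * (EFin \o u) x)%E) => //.
exact: integrableZl.
Qed.

Lemma integrableD_real A (u v : T -> R) : measurable A ->
  mu.-integrable A (EFin \o u) -> mu.-integrable A (EFin \o v) ->
  mu.-integrable A (EFin \o (fun x => u x + v x)).
Proof.
move=> mA ui vi; apply: (eq_integrable mA ((EFin \o u) \+ (EFin \o v))%E) => //.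
exact: integrableD.
Qed.

Lemma kintegrableP A f : L0 f -> measurable A ->
  kintegrable A f <-> (\int[mu]_(x in A) (kabs (f x : K))%:E < +oo)%E.
Proof.
move=> Lf mA; have mf : measurable_fun A (fun x => kabs (f x : K)).
  exact/measurable_funTS/L0_kabs.
have -> : (\int[mu]_(x in A) (kabs (f x : K))%:E =
    \int[mu]_(x in A) `|(kabs (f x : K))%:E|)%E.
  by apply: eq_integral => x _; rewrite /= ger0_norm ?kabs_ge0.
split=> [[_ /integrableP[]//]|foo]; split => //.
by apply/integrableP; split => //; exact/measurable_EFinP.
Qed.

Lemma kint_normE A f : kintegrable A f -> measurable A ->
  (\int[mu]_(x in A) (kabs (f x : K))%:E)%E = (kint_norm A f)%:E.
Proof. by move=> [_ fi] mA; rewrite fineK// integrable_fin_num. Qed.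

Lemma kintegrable_le A f g : measurable A -> L0 f -> kintegrable A g ->
  (exists C : R, forall x, kabs (f x : K) <= C * kabs (g x : K)) ->
  kintegrable A f.
Proof.
move=> mA Lf [_ gi] [C fg]; split=> //.
apply: (@le_integrable _ _ _ mu A mA _ (fun x => C%:E * (kabs (g x : K))%:E)%E).
- by apply/measurable_EFinP/measurable_funTS/L0_kabs.
- move=> x _; rewrite /= lee_fin ger0_norm ?kabs_ge0//.
  by rewrite (le_trans (fg x))// ler_norm.
- exact: integrableZl.
Qed.

Lemma kintegrableS A B f : measurable A -> measurable B -> A `<=` B ->
  kintegrable B f -> kintegrable A f.
Proof. by move=> mA mB AB [Lf fi]; split => //; exact: integrableS fi. Qed.

Lemma kintegrable_lin A (a : K) f g : measurable A ->
  kintegrable A f -> kintegrable A g ->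
  kintegrable A (fun x => (a * f x + g x : K)).
Proof.
move=> mA [Lf fi] [Lg gi].
have Lafg : L0 (fun x => (a * f x + g x : K) : K^o).
  by apply: L0D => //; apply: L0M => //; exact: L0_cst.
split=> //.
apply: (@le_integrable _ _ _ mu A mA _
  (fun x => (kabs a)%:E * (kabs (f x : K))%:E + (kabs (g x : K))%:E)%E).
- by apply/measurable_EFinP/measurable_funTS/L0_kabs.
- move=> x _; rewrite /= lee_fin ger0_norm ?kabs_ge0//.
  by rewrite (le_trans (kabsD _ _))// kabsM ler_norm.
- by apply: integrableD => //; exact: integrableZl.
Qed.

Lemma kintegrable_coord A f : measurable A -> kintegrable A f ->
  mu.-integrable A (EFin \o (fun x => kre (f x : K))) /\
  mu.-integrable A (EFin \o (fun x => kim (f x : K))).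
Proof.
move=> mA [Lf fi]; split; apply: le_integrable fi => //.
- by apply/measurable_EFinP/measurable_funTS/L0_re.
- by move=> x _ /=; rewrite lee_fin (ger0_norm (kabs_ge0 _)) kre_le.
- by apply/measurable_EFinP/measurable_funTS/L0_im.
- by move=> x _ /=; rewrite lee_fin (ger0_norm (kabs_ge0 _)) kim_le.
Qed.

Lemma kre_kint A f : kre (kint A f) = Rintegral mu A (fun x => kre (f x : K)).
Proof. by rewrite kre_mk. Qed.

Lemma kim_kint A f : kim (kint A f) = Rintegral mu A (fun x => kim (f x : K)).
Proof.
rewrite kim_mk// => kR; rewrite /Rintegral integral0_eq// => x _.
by rewrite kim_real.
Qed.

Lemma kint_lin A (a : K) f g : measurable A ->
  kintegrable A f -> kintegrable A g ->
  kint A (fun x => (a * f x + g x : K)) = a * kint A f + kint A g.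
Proof.
move=> mA fi gi.
have [fr fm] := kintegrable_coord mA fi; have [gr gm] := kintegrable_coord mA gi.
apply: kext.
  rewrite kreD kreM !kre_kint !kim_kint.
  under eq_Rintegral do rewrite kreD kreM -mulNr.
  by rewrite !RintegralD ?RintegralZl ?mulNr//;
    do ?apply: integrableD_real => //; exact: integrableZ_real.
rewrite kimD kimM !kre_kint !kim_kint.
under eq_Rintegral do rewrite kimD kimM.
by rewrite !RintegralD ?RintegralZl//;
  do ?apply: integrableD_real => //; exact: integrableZ_real.
Qed.

(** Pairing the integral with itself turns the triangle inequality into the
    pointwise Cauchy-Schwarz inequality. *)
Lemma kabs_kint_le A f : measurable A -> kintegrable A f ->
  kabs (kint A f) <= kint_norm A f.
Proof.
move=> mA fi; set z := kint A f.
have [fr fm] := kintegrable_coord mA fi.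
have : kabs z ^+ 2 <= kabs z * kint_norm A f.
  rewrite kabs_sqr !expr2 {2}/z {3}/z kre_kint kim_kint.
  rewrite -!RintegralZl//; last by case: fi.
  rewrite -RintegralD//; try exact: integrableZ_real.
  apply: le_Rintegral => //.
  - by apply: integrableD_real => //; exact: integrableZ_real.
  - by apply: integrableZ_real => //; case: fi.
  - by move=> x _; rewrite -kre_kint -kim_kint; exact: kre_kim_dot.
have [->|z0] := eqVneq (kabs z) 0.
  by move=> _; apply: Rintegral_ge0 => x _; exact: kabs_ge0.
by rewrite expr2 ler_pM2l// lt_def z0 kabs_ge0.
Qed.

Lemma ae_integral_eq A f g (c : K^o -> R) : measurable A ->
  measurable_fun setT (c \o f) -> measurable_fun setT (c \o g) ->
  {ae mu, forall x, A x -> f x = g x} ->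
  (\int[mu]_(x in A) (c (f x))%:E = \int[mu]_(x in A) (c (g x))%:E)%E.
Proof.
move=> mA mf mg fg; apply: ae_eq_integral => //.
- exact/measurable_EFinP/measurable_funTS.
- exact/measurable_EFinP/measurable_funTS.
- by apply: filterS fg => x h Ax; rewrite h.
Qed.

Lemma kint_ae A f g : measurable A -> L0 f -> L0 g ->
  {ae mu, forall x, A x -> f x = g x} -> kint A f = kint A g.
Proof.
move=> mA Lf Lg fg; rewrite /kint /Rintegral.
rewrite (ae_integral_eq (c := fun z => kre (z : K)) mA (L0_re Lf) (L0_re Lg) fg).
by rewrite (ae_integral_eq (c := fun z => kim (z : K)) mA (L0_im Lf) (L0_im Lg) fg).
Qed.

Lemma kint_norm_ae A f g : measurable A -> L0 f -> L0 g ->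
  {ae mu, forall x, A x -> f x = g x} ->
  (\int[mu]_(x in A) (kabs (f x : K))%:E = \int[mu]_(x in A) (kabs (g x : K))%:E)%E.
Proof.
move=> mA Lf Lg fg.
exact: (ae_integral_eq (c := fun z => kabs (z : K)) mA (L0_kabs Lf) (L0_kabs Lg) fg).
Qed.

Lemma kint_indic A f : kint setT (fun x => (f x : K) * (\1_A x : K^o)) = kint A f.
Proof.
by rewrite /kint; congr kmk; rewrite [RHS]Rintegral_mkcond;
  apply: eq_Rintegral => x _; rewrite indic_mulE patchE;
  case: ifP => //; rewrite (kre0, kim0).
Qed.

Lemma kint_cst A (c : K) : measurable A ->
  kint A (fun=> c) = kmk k (fine (mu A)) 0 * c.
Proof.
move=> mA; rewrite /kint !Rintegral_cst//; apply: kext.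
  rewrite kre_mk kreM kre_mk kim_mk// mul0r subr0; exact: mulrC.
rewrite kim_mk ?kimM ?kre_mk ?kim_mk// => [|kR]; first by rewrite mul0r addr0 mulrC.
by rewrite kim_real// mul0r.
Qed.

End ScalarIntegral.

(** * Variation of an indefinite integral *)

Section Convergence.
Context {R : realType} {k : scalar_kind}.
Local Notation K := (scalar_field R k).
Context {d : measure_display} {T : measurableType d}.
Context (mu : {measure set T -> \bar R}).
Implicit Types (f g : T -> K^o) (A B : set T).

(** Dominated convergence to zero, in the form used both to compute variations
    and to prove the density of simple functions. *)
Lemma kint_norm_cvg0 A (u : nat -> T -> K^o) g (C : R) : measurable A ->
  (forall n, L0 (u n)) -> kintegrable mu A g ->
  (forall n x, kabs (u n x : K) <= C * kabs (g x : K)) ->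
  (forall x, A x -> u n x @[n --> \oo] --> (0 : K^o)) ->
  kint_norm mu A (u n) @[n --> \oo] --> (0 : R).
Proof.
move=> mA Lu [Lg gi] ug u0.
have : (\int[mu]_(x in A) (kabs (u n x : K))%:E)%E @[n --> \oo] -->
    (\int[mu]_(x in A) (cst 0 x))%E.
  apply: (@dominated_cvg _ _ _ mu A mA _ _ (fun x => C%:E * (kabs (g x : K))%:E)%E).
  - by move=> n; apply/measurable_EFinP/measurable_funTS/L0_kabs.
  - move=> x Ax; apply: cvg_EFin; first exact: nearW.
    have /cvg_kabsP := u0 x Ax; by under eq_cvg do rewrite subr0.
  - by [].
  - exact: integrableZl.
  - by move=> n x _ /=; rewrite lee_fin ger0_norm ?kabs_ge0.
by rewrite integral_cst// mul0e => /fine_cvg.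
Qed.

(** On a set where [s] is constant its integral has no cancellation. Replacing
    [h] by [s] and [s] by [h] costs the [L^1] distance between them, once for the
    norm of [h] and once for the modulus of its integral. *)
Lemma kint_norm_level C (c : K) (s h : T -> K^o) : measurable C ->
  (forall x, C x -> s x = c) -> kintegrable mu C h -> kintegrable mu C s ->
  kint_norm mu C h <=
  kabs (kint mu C h) + 2 * kint_norm mu C (fun x => (-1 * s x + h x : K)).
Proof.
move=> mC sc hi si; set D := kint_norm mu C (fun x => (-1 * s x + h x : K)).
have di : kintegrable mu C (fun x => (-1 * s x + h x : K)).
  exact: kintegrable_lin.
have normc : kint_norm mu C s = kabs (kint mu C s).
  have -> : kint_norm mu C s = kint_norm mu C (fun=> c).
    by apply: eq_Rintegral => x /set_mem Cx; rewrite sc.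
  have -> : kint mu C s = kint mu C (fun=> c).
    by rewrite /kint; congr kmk; apply: eq_Rintegral => x /set_mem Cx; rewrite sc.
  rewrite kint_cst// kabsM /kint_norm Rintegral_cst// mulrC.
  congr (_ * _); rewrite kabsE kre_mk kim_mk// expr0n addr0 sqrtr_sqr ger0_norm//.
have h_le : kint_norm mu C h <= kint_norm mu C s + D.
  rewrite /D /kint_norm -RintegralD//; [|by case: si|by case: di].
  apply: le_Rintegral => //; first by case: hi.
    by apply: integrableD_real => //; [case: si|case: di].
  move=> x _; apply: le_trans (kabsD _ _).
  by rewrite mulN1r addrA subrr add0r.
have s_le : kabs (kint mu C s) <= kabs (kint mu C h) + D.
  have := kabs_kint_le mC di; rewrite kint_lin//.
  have := kabsD (kint mu C h) (- (-1 * kint mu C s + kint mu C h)).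
  by rewrite kabsN mulN1r opprD opprK addrCA subrr addr0 -/D; lra.
by rewrite -normc in s_le; lra.
Qed.

Lemma measurable_level (s : T -> K^o) (c : K^o) : L0 s ->
  measurable (s @^-1` [set c]).
Proof.
move=> Ls; have -> : s @^-1` [set c] =
    ~` [set x | (((fun x => s x + cst (- c : K^o) x) x : K^o) != 0)%R].
  apply/seteqP; split => x /=; rewrite subr_eq0.
    by move=> ->; rewrite eqxx.
  by move=> /negP/negPn/eqP.
by apply: measurableC; apply: L0_neq0; apply: L0D => //; exact: L0_cst.
Qed.

Lemma kint_norm_levels B (s f : T -> K^o) (cs : seq K^o) :
  measurable B -> L0 s -> uniq cs -> (forall x, B x -> s x \in cs) ->
  kintegrable mu B f ->
  kint_norm mu B f = \sum_(c <- cs) kint_norm mu (B `&` s @^-1` [set c]) f.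
Proof.
move=> mB Ls ucs scs fi.
have mBc c : measurable (B `&` s @^-1` [set c]).
  by apply: measurableI => //; exact: measurable_level.
have EB : \big[setU/set0]_(c <- cs) (B `&` s @^-1` [set c]) = B.
  rewrite -bigcup_seq; apply/seteqP; split => x /=; first by move=> [c _ []].
  by move=> Bx; exists (s x) => //=; exact: scs.
apply: EFin_inj; rewrite -kint_normE//.
rewrite -{1}EB ge0_integral_bigsetU//.
- rewrite -sumEFin; apply: eq_bigr => c _; rewrite kint_normE//.
  by apply: kintegrableS fi => //; exact: subIsetl.
- by move=> i j _ _ [x [[_ <-] [_ <-]]].
- by apply/measurable_EFinP/measurable_funTS/L0_kabs; case: fi.
- by move=> x _; rewrite lee_fin kabs_ge0.
Qed.

End Convergence.

Section Variation.
Context {R : realType} {k : scalar_kind}.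
Local Notation K := (scalar_field R k).
Context {d : measure_display} {T : measurableType d}.
Context (mu : {measure set T -> \bar R}).
Context (h : T -> K^o) (E : nat -> set T) (lam : set T -> K^o).
Hypothesis (Lh : L0 h) (hE : exhausts mu E h).
Hypothesis hloc : forall B, finite_sets mu B -> kintegrable mu B h.
Hypothesis lamE : forall B, finite_sets mu B -> lam B = kint mu B h.
Implicit Types A B : set T.

Let mh : measurable_fun setT (EFin \o (fun x => kabs (h x : K))).
Proof. exact/measurable_EFinP/L0_kabs. Qed.

(** The level sets in [B] of a simple approximation of [h] form an admissible
    family for the variation, and by [kint_norm_level] it misses the norm of [h]
    by at most twice the approximation error. This treats real and complex
    scalars alike, without the polar decomposition of [h]. *)
Lemma variation_ge_kint_norm A B : finite_sets mu B -> B `<=` A ->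
  ((kint_norm mu B h)%:E <= scalar_variation mu lam A)%E.
Proof.
move=> fB BA; have [mB _] := fB; have hi := hloc fB.
have [s [Ls fs sl sc]] := L0_simple_approx Lh.
have si n A' : measurable A' -> A' `<=` B -> kintegrable mu A' (s n).
  move=> mA' AB; apply: (kintegrable_le mA' (Ls n) (kintegrableS mA' mB AB hi)).
  by exists 2 => x.
pose D n := kint_norm mu B (fun x => (-1 * s n x + h x : K)).
have D0 : D n @[n --> \oo] --> 0.
  (* [3]: the approximations are dominated by [2 * kabs h]. *)
  apply: (@kint_norm_cvg0 _ _ _ _ mu B (fun n x => (-1 * s n x + h x : K) : K^o)
    h 3 mB) => //.
  - by move=> n; apply: L0D => //; apply: L0M => //; exact: L0_cst.
  - move=> n x; have := kabsD (-1 * s n x : K) (h x).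
    by have := sl n x; rewrite mulN1r kabsN; lra.
  - move=> x _; apply/cvg_kabsP; have /cvg_kabsP := sc x.
    apply: cvg_trans; apply: near_eq_cvg; apply: nearW => n.
    by rewrite /= subr0 mulN1r -kabsN opprD opprK.
have step n : ((kint_norm mu B h - 2 * D n)%:E <= scalar_variation mu lam A)%E.
  have /finite_seqP[cs0 rs] := fs n; pose cs := undup cs0.
  have ucs : uniq cs by exact: undup_uniq.
  have scs x : B x -> s n x \in cs.
    move=> _; rewrite mem_undup; have : range (s n) (s n x) by exists x.
    by rewrite rs.
  pose L c := B `&` s n @^-1` [set c].
  have mL c : measurable (L c).
    by apply: measurableI; [exact: mB|exact: measurable_level].
  have fL c : finite_sets mu (L c) by apply: (finite_setsS fB (mL c)) => x [].
  apply: (@le_trans _ _ (\sum_(c <- cs) kabs (lam (L c) : K))%:E).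
    rewrite lee_fin lerBlDr (kint_norm_levels mB (Ls n) ucs scs hi).
    rewrite /D (kint_norm_levels mB (Ls n) ucs scs); last first.
      by apply: kintegrable_lin => //; exact: si.
    rewrite mulr_sumr -big_split/=; apply: ler_sum => c _.
    rewrite lamE//; apply: (@kint_norm_level _ _ _ _ _ _ c _ _ (mL c)).
    - by move=> x [].
    - exact: hloc.
    - by apply: (si _ _ (mL c)) => x [].
  apply: ereal_sup_ubound => /=.
  exists (size cs), (fun i : 'I_(size cs) => L (nth 0 cs i)); split.
  - by move=> i; split => // x [/BA].
  - move=> i j _ _ [x [[_ xi] [_ xj]]]; apply/val_inj/eqP.
    by rewrite -(nth_uniq 0 _ _ ucs) ?ltn_ord// -xi -xj.
  - by congr EFin; rewrite (big_nth 0) big_mkord.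
have : (kint_norm mu B h - 2 * D n)%:E @[n --> \oo] --> (kint_norm mu B h)%:E.
  apply: cvg_EFin; first exact: nearW.
  rewrite -[X in _ --> X](subr0 (kint_norm mu B h)) -[X in _ - X](mulr0 2).
  by apply: cvgB; [exact: cvg_cst|apply: cvgM => //; exact: cvg_cst].
move=> cD; rewrite -(cvg_lim _ cD)//.
by apply: lime_le; [apply/cvg_ex; eexists; exact: cD|exact: nearW].
Qed.

(** The upper bound is the triangle inequality on each member of a disjoint
    family. For the lower bound, [A] is exhausted by the sets of finite measure
    [A `&` E n]: what lies outside of all of them does not contribute, since [h]
    vanishes there. *)
Lemma variation_kint A : measurable A ->
  scalar_variation mu lam A = (\int[mu]_(x in A) (kabs (h x : K))%:E)%E.
Proof.
move=> mA; have [fE ndE Esupp] := hE; apply/eqP; rewrite eq_le; apply/andP; split.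
  apply: ge_ereal_sup => _ /= [n [B [BA tB ->]]].
  have mB i : measurable (B i) by have [[]] := BA i.
  rewrite -sumEFin; apply: (@le_trans _ _
      (\sum_(i < n) \int[mu]_(x in B i) (kabs (h x : K))%:E)%E).
    apply: lee_sum => i _; have [fB _] := BA i.
    by rewrite kint_normE ?lee_fin ?lamE ?kabs_kint_le//; exact: hloc.
  rewrite -ge0_integral_bigsetU//.
  - apply: ge0_subset_integral => //.
    + exact: bigsetU_measurable.
    + exact: measurable_funTS.
    + by move=> x _; rewrite lee_fin kabs_ge0.
    + by rewrite -bigcup_seq => x [i _]; have [_] := BA i; exact.
  - exact: index_enum_uniq.
  - by apply: sub_trivIset tB.
  - exact: measurable_funTS.
  - by move=> x _; rewrite lee_fin kabs_ge0.
pose G n := A `&` E n.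
have mG n : measurable (G n) by apply: measurableI => //; have [] := fE n.
have cG : (\int[mu]_(x in G n) (kabs (h x : K))%:E)%E @[n --> \oo] -->
    (\int[mu]_(x in \bigcup_n G n) (kabs (h x : K))%:E)%E.
  apply: ge0_nondecreasing_set_cvg_integral => //.
  - move=> n m nm; apply/subsetPset => x [Ax Ex]; split => //.
    by have /subsetPset := ndE _ _ nm; exact.
  - by move=> n; exact: measurable_funTS.
  - by move=> n x _; rewrite lee_fin kabs_ge0.
have -> : (\int[mu]_(x in A) (kabs (h x : K))%:E =
           \int[mu]_(x in \bigcup_n G n) (kabs (h x : K))%:E)%E.
  rewrite [LHS]integral_mkcond [RHS]integral_mkcond; apply: eq_integral => x _.
  rewrite !patchE; case: ifPn => [/set_mem Ax|nAx].
    case: ifPn => // nGx.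
    have [->|/Esupp[n En]] := pselect (h x = 0); first by rewrite kabs0.
    by exfalso; move/negP: nGx; apply; apply/mem_set; exists n.
  case: ifPn => // Gx.
  by exfalso; move/negP: nAx; apply; apply/mem_set; have /set_mem[n _ []] := Gx.
rewrite -(cvg_lim _ cG)//.
apply: lime_le; first by apply/cvg_ex; eexists; exact: cG.
apply: nearW => n; have fG : finite_sets mu (G n).
  by apply: (finite_setsS (fE n) (mG n)) => x [].
by rewrite kint_normE//; [apply: variation_ge_kint_norm => // x []|exact: hloc].
Qed.

End Variation.

(** * Integration against a variation *)

(** Simple functions only see measurable sets, so the integral depends on a set
    function through its values there; a variation, defined on all sets, may
    thus be integrated as if it were a measure. *)
Lemma eq_setfun_integral {R : realType} {d : measure_display}
    {T : measurableType d} (m1 m2 : set T -> \bar R) (f : T -> \bar R) :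
  (forall A, measurable A -> m1 A = m2 A) ->
  (\int[m1]_x f x = \int[m2]_x f x)%E.
Proof.
move=> m12; rewrite /integral.
have E (s : {nnsfun T >-> R}) : sintegral m1 s = sintegral m2 s.
  by apply: eq_fsbigr => y _; rewrite m12.
by congr (ereal_sup _ - ereal_sup _)%E; apply: eq_imagel => s _; exact: E.
Qed.

Section Density.
Context {R : realType} {d : measure_display} {T : measurableType d}.
Context (mu : {measure set T -> \bar R}) (w : T -> R).
Hypotheses (mw : measurable_fun setT w) (w0 : forall x, 0 <= w x).

(** The proofs are arguments of the set function so that it carries the measure
    structure declared below. *)
Definition density_measure of measurable_fun setT w & (forall x, 0 <= w x) :=
  fun A : set T => (\int[mu]_(x in A) (w x)%:E)%E.

Local Notation dm := (density_measure mw w0).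

Let dm0 : dm set0 = 0%E.
Proof. exact: integral_set0. Qed.

Let dm_ge0 A : (0 <= dm A)%E.
Proof. by apply: integral_ge0 => x _; rewrite lee_fin. Qed.

Let dm_sigma_additive : semi_sigma_additive dm.
Proof.
move=> F mF tF mUF; rewrite /density_measure ge0_integral_bigcup//.
- by apply: is_cvg_ereal_nneg_natsum => n _; exact: dm_ge0.
- exact/measurable_EFinP/measurable_funTS.
- by move=> x _; rewrite lee_fin.
Qed.

HB.instance Definition _ := isMeasure.Build _ _ _ dm dm0 dm_ge0 dm_sigma_additive.

Lemma integral_density_nnsfun (s : {nnsfun T >-> R}) :
  (\int[dm]_x (s x)%:E = \int[mu]_x (s x * w x)%:E)%E.
Proof.
have mE : measurable_fun setT (EFin \o w) by exact/measurable_EFinP.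
rewrite integral_nnsfun// (_ : s \_ setT = s); last by rewrite patch_setT.
rewrite sintegralE.
transitivity (\int[mu]_x (\sum_(y \in range s)
    ((y * \1_(s @^-1` [set y]) x)%:E * (w x)%:E)))%E; last first.
  apply: eq_integral => x _; rewrite -ge0_mule_fsuml => [|y]; last first.
    exact: nnfun_muleindic_ge0.
  by rewrite fsumEFin// -(fimfunE _ x).
rewrite ge0_integral_fsum//; last 2 first.
- by move=> y; apply: emeasurable_funM => //; apply/measurable_EFinP;
    exact: measurable_funM.
- by move=> y x _; rewrite mule_ge0 ?nnfun_muleindic_ge0// lee_fin.
apply: eq_fsbigr => y /set_mem[t _ <-].
under eq_integral do rewrite EFinM -muleA.
rewrite ge0_integralZl//.
- congr (_ * _)%E; transitivity (\int[mu]_(x in s @^-1` [set s t]) (w x)%:E)%E.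
    by [].
  by rewrite integral_mkcond; apply: eq_integral => x _; rewrite epatch_indic muleC.
- by apply: emeasurable_funM => //; exact/measurable_EFinP.
- by move=> x _; rewrite mule_ge0 ?lee_fin.
- by rewrite lee_fin.
Qed.

Lemma integral_density (f : T -> R) : measurable_fun setT f ->
  (forall x, 0 <= f x) ->
  (\int[dm]_x (f x)%:E = \int[mu]_x (f x * w x)%:E)%E.
Proof.
move=> mf f0; have mEf : measurable_fun setT (EFin \o f).
  exact/measurable_EFinP.
have Ef0 x : [set: T] x -> (0 <= (EFin \o f) x)%E by rewrite /= lee_fin.
pose s := nnsfun_approx measurableT mEf.
have cs x := cvg_nnsfun_approx measurableT mEf Ef0 (I : [set: T] x).
have nds n m x : (n <= m)%N -> s n x <= s m x.
  by move=> nm; exact/lefP/nd_nnsfun_approx.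
have -> : (\int[dm]_x (f x)%:E = limn (fun n => \int[dm]_x (s n x)%:E))%E.
  rewrite -monotone_convergence//.
  - by apply: eq_integral => x _; apply/esym/cvg_lim => //; exact: cs.
  - by move=> n; exact/measurable_EFinP.
  - by move=> n x _; rewrite lee_fin.
  - by move=> x _ n m nm; rewrite lee_fin; exact: nds.
have -> : (\int[mu]_x (f x * w x)%:E =
    limn (fun n => \int[mu]_x (s n x * w x)%:E))%E.
  rewrite -monotone_convergence//.
  - apply: eq_integral => x _; apply/esym/cvg_lim => //.
    under eq_fun do rewrite EFinM.
    by rewrite EFinM; apply: cvgeZr => //; exact: cs.
  - by move=> n; apply/measurable_EFinP/measurable_funM.
  - by move=> n x _; rewrite lee_fin mulr_ge0.
  - by move=> x _ n m nm; rewrite lee_fin ler_wpM2r// nds.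
have E n := integral_density_nnsfun (s n).
by under eq_fun do rewrite E.
Qed.

End Density.

(** * The integral against a scalar measure with density *)

Section ScalarMeasureIntegral.
Context {R : realType} {k : scalar_kind}.
Local Notation K := (scalar_field R k).
Context {d : measure_display} {T : measurableType d}.
Context (mu : {measure set T -> \bar R}).
Context (h : T -> K^o) (E : nat -> set T) (lam : set T -> K^o).
Hypothesis (Lh : L0 h) (hE : exhausts mu E h).
Hypothesis hloc : forall B, finite_sets mu B -> kintegrable mu B h.
Hypothesis lamE : forall B, finite_sets mu B -> lam B = kint mu B h.
Implicit Types (A B : set T) (f g : T -> K^o).

Local Notation var := (scalar_variation mu lam).
Local Notation mulh f := (fun x => (f x : K) * (h x : K) : K^o).

(** The variation has density [kabs h] with respect to [mu] by
    [variation_kint]. *)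
Lemma integral_variation f : L0 f ->
  (\int[var]_x (kabs (f x : K))%:E = \int[mu]_x (kabs (mulh f x : K))%:E)%E.
Proof.
move=> Lf; have h0 x := kabs_ge0 (h x : K).
rewrite (@eq_setfun_integral _ _ _ _ (density_measure mu (L0_kabs Lh) h0)).
  rewrite (integral_density mu _ _ (L0_kabs Lf) (fun x => kabs_ge0 (f x : K))).
  by under eq_integral do rewrite -kabsM.
by move=> A mA; rewrite (variation_kint Lh hE hloc lamE).
Qed.

Lemma L1fun_variation f : L0 f -> L1fun var f <-> kintegrable mu setT (mulh f).
Proof.
move=> Lf; have Lfh : L0 (mulh f) by exact: L0M.
rewrite kintegrableP// -integral_variation//.
by split=> [[]//|foo]; split.
Qed.

Lemma L1fun_kintegrable_mul f : L1fun var f -> kintegrable mu setT (mulh f).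
Proof. by move=> fL; apply/L1fun_variation => //; case: fL. Qed.

Lemma kintegrable_indic A f : measurable A -> L0 f -> kintegrable mu A f ->
  kintegrable mu setT (fun x => (f x : K) * (\1_A x : K^o)).
Proof.
move=> mA Lf fi; have LfA : L0 (fun x => (f x : K) * (\1_A x : K^o)).
  by apply: L0M => //; exact: L0_indic.
apply/kintegrableP => //.
have := (kintegrableP mu Lf mA).1 fi; rewrite integral_mkcond.
congr (_ < _)%E; apply: eq_integral => x _; rewrite indic_mulE patchE.
by case: ifP => //; rewrite kabs0.
Qed.

Lemma L1fun_variation_indic A : finite_sets mu A -> L1fun var (\1_A : T -> K^o).
Proof.
move=> fA; have [mA _] := fA; apply/L1fun_variation; first exact: L0_indic.
under eq_fun do rewrite mulrC.
by apply: kintegrable_indic => //; exact: hloc.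
Qed.

Lemma L1fun_variation_lin (a : K) f g : L1fun var f -> L1fun var g ->
  L1fun var (fun x => a * f x + g x : K).
Proof.
move=> fL gL; have [Lf _] := fL; have [Lg _] := gL.
have Lfg : L0 (fun x => a * f x + g x : K).
  by apply: L0D => //; apply: L0M => //; exact: L0_cst.
apply/L1fun_variation => //.
have -> : mulh (fun x => a * f x + g x : K) =
    (fun x => (a * mulh f x + mulh g x : K)).
  by apply/funext => x; rewrite mulrDl mulrA.
by apply: kintegrable_lin => //; exact: L1fun_kintegrable_mul.
Qed.

Lemma is_scalar_integral_kint :
  is_scalar_integral mu lam (fun f => kint mu setT (mulh f)).
Proof.
split=> [a f g fL gL||A fA].
- rewrite -kint_lin//; try exact: L1fun_kintegrable_mul.
  by congr kint; apply/funext => x; rewrite mulrDl mulrA.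
- exists 1 => f fL; rewrite mul1e; have [Lf _] := fL.
  have fi := L1fun_kintegrable_mul fL.
  by rewrite integral_variation// kint_normE// lee_fin kabs_kint_le.
- by under eq_fun do rewrite mulrC; rewrite kint_indic lamE.
Qed.

(** A finite combination of indicators of sets of finite measure is reached by
    linearity alone; the empty one is handled by [0 = -1 * 0 + 0]. *)
Lemma scalar_integral_simple (I J : (T -> K^o) -> K) (l : seq (K * set T)) :
  is_scalar_integral mu lam I -> is_scalar_integral mu lam J ->
  (forall p, p \in l -> finite_sets mu p.2) ->
  let f : T -> K^o := fun x => \sum_(p <- l) p.1 * (\1_(p.2) x : K^o) in
  L1fun var f /\ I f = J f.
Proof.
move=> [Ilin _ Iind] [Jlin _ Jind]; elim: l => [_|p l IH fl] /=.
  have L0 : L1fun var (fun x : T => 0 : K^o).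
    have -> : (fun x : T => 0 : K^o) = (\1_set0 : T -> K^o).
      by apply/funext => x; rewrite indicE in_set0.
    by apply: L1fun_variation_indic; split => //; rewrite measure0.
  under eq_fun do rewrite big_nil; split => //.
  have z : (fun x : T => -1 * 0 + 0 : K) = (fun x : T => 0).
    by apply/funext => x; rewrite mulr0 addr0.
  have := Ilin (-1) _ _ L0 L0; have := Jlin (-1) _ _ L0 L0.
  by rewrite z !mulN1r !addNr => -> ->.
have [|sL IJ] := IH.
  by move=> q ql; apply: fl; rewrite inE ql orbT.
have fp : finite_sets mu p.2 by apply: fl; rewrite mem_head.
have pL := L1fun_variation_indic fp.
under eq_fun do rewrite big_cons; split; first exact: L1fun_variation_lin.
by rewrite Ilin// Jlin// IJ Iind// Jind.
Qed.

(** Simple functions with supports of finite measure are dense in [L^1] of the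
    variation: simple approximations of [f] are cut off along the exhaustion [E]
    and dominated convergence applies. Two continuous extensions of the same
    measure therefore agree. *)
Lemma scalar_integral_unique (I J : (T -> K^o) -> K) f :
  is_scalar_integral mu lam I -> is_scalar_integral mu lam J ->
  L1fun var f -> I f = J f.
Proof.
move=> hI hJ fL; have [Lf _] := fL; have [fE ndE Eh] := hE.
have [s [Ls fs sl sc]] := L0_simple_approx Lf.
(* [s n] cut off outside [E n], so that it is supported in finite measure. *)
pose t n : T -> K^o := fun x => (s n x : K) * (\1_(E n) x : K^o).
have tIJ n : L1fun var (t n) /\ I (t n) = J (t n).
  have /finite_seqP[cs0 rs] := fs n; pose cs := undup cs0.
  pose l := [seq (c : K, E n `&` s n @^-1` [set (c : K^o)]) | c <- cs].
  have tE : t n = fun x => \sum_(p <- l) p.1 * (\1_(p.2) x : K^o).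
    apply/funext => x; rewrite /t /l big_map.
    have xcs : s n x \in cs.
      rewrite mem_undup; have : range (s n) (s n x) by exists x.
      by rewrite rs.
    rewrite (bigD1_seq (s n x)) ?undup_uniq//= big1_seq => [|c /andP[cx _]].
      have xs : x \in s n @^-1` [set s n x] by exact/mem_set.
      by rewrite addr0 !indicE in_setI xs andbT.
    rewrite indicE memNset ?mulr0// => -[_ /= sx].
    by move: cx; rewrite sx eqxx.
  rewrite tE; apply: scalar_integral_simple => // _ /mapP[c _ ->] /=.
  apply: (finite_setsS (fE n)) => [|x []//].
  by apply: measurableI; [by have [] := fE n|exact: measurable_level].
pose D n := kint_norm mu setT (fun x => (-1 * t n x + f x) * (h x : K)).
have D0 : D n @[n --> \oo] --> 0.
  have Lt n : L0 (t n) by have [[]] := tIJ n.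
  apply: (@kint_norm_cvg0 _ _ _ _ mu setT
    (fun n x => ((-1 * t n x + f x) * (h x : K)) : K^o) (mulh f) 3) => //.
  - move=> n; apply: L0M => //; apply: L0D => //; apply: L0M => //.
    exact: L0_cst.
  - exact: L1fun_kintegrable_mul.
  - move=> n x; rewrite !kabsM mulrA ler_wpM2r ?kabs_ge0//.
    have tl : kabs (t n x : K) <= kabs (s n x : K).
      by rewrite /t indic_mulE; case: ifP; rewrite ?kabs0 ?kabs_ge0.
    have := kabsD (-1 * t n x : K) (f x); have := sl n x.
    by rewrite mulN1r kabsN; lra.
  - move=> x _; apply/cvg_kabsP.
    have [hx|/Eh[m Em]] := pselect (h x = 0).
      under eq_cvg do rewrite hx mulr0 subr0 kabs0; exact: cvg_cst.
    have /cvg_kabsP sfx := sc x.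
    rewrite -(mul0r (kabs (h x : K))).
    apply: cvg_trans (cvgM sfx (cvg_cst (kabs (h x : K)))).
    apply: near_eq_cvg; exists m => // n /= mn.
    rewrite subr0 kabsM; congr (_ * _).
    rewrite /t indic_mulE mem_set; first by rewrite mulN1r -kabsN opprD opprK.
    by have /subsetPset := ndE _ _ mn; exact.
have bound (P : (T -> K^o) -> K) : is_scalar_integral mu lam P ->
    exists C : R, forall n, kabs (P f - P (t n)) <= C * D n.
  move=> [Plin [C PC] _]; exists C => n; have [tL _] := tIJ n.
  have dL := L1fun_variation_lin (-1) tL fL.
  have := PC _ dL; have [Ld _] := dL.
  rewrite integral_variation// kint_normE//; last exact: L1fun_kintegrable_mul.
  by rewrite -EFinM lee_fin Plin// mulN1r addrC.
have [C1 hC1] := bound _ hI; have [C2 hC2] := bound _ hJ.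
have le0 n : kabs (I f - J f) <= (C1 + C2) * D n.
  have [_ IJ] := tIJ n; have := hC1 n; have := hC2 n.
  have := kabsD (I f - I (t n)) (- (J f - J (t n))).
  rewrite kabsN IJ opprB addrA subrK; lra.
apply/eqP; rewrite -subr_eq0; apply/eqP/kabs0_eq0/eqP.
rewrite eq_le kabs_ge0 andbT.
have cD : (C1 + C2) * D n @[n --> \oo] --> (0 : R).
  rewrite -[X in _ --> X](mulr0 (C1 + C2)).
  by apply: cvgM => //; exact: cvg_cst.
rewrite -(cvg_lim _ cD)//.
by apply: limr_ge; [apply/cvg_ex; eexists; exact: cD|exact: nearW].
Qed.

(** [scalar_integral] is some functional with the characteristic properties;
    [is_scalar_integral_kint] shows that one exists and
    [scalar_integral_unique] that it is this one. *)
Lemma scalar_integral_onE A f : measurable A -> L1fun var f ->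
  scalar_integral_on mu lam A f = kint mu A (mulh f).
Proof.
move=> mA fL; have [Lf _] := fL.
have hS : is_scalar_integral mu lam (scalar_integral mu lam).
  by apply: xgetPex; exists (fun f => kint mu setT (mulh f));
    exact: is_scalar_integral_kint.
have fAL : L1fun var (fun x => (f x : K) * (\1_A x : K^o)).
  have LfA : L0 (fun x => (f x : K) * (\1_A x : K^o)).
    by apply: L0M => //; exact: L0_indic.
  apply/L1fun_variation => //.
  apply: (kintegrable_le measurableT _ (L1fun_kintegrable_mul fL)).
    exact: L0M.
  exists 1 => x; rewrite mul1r !kabsM ler_wpM2r ?kabs_ge0//.
  by rewrite -kabsM indic_mulE; case: ifP; rewrite ?kabs0 ?kabs_ge0.
rewrite /scalar_integral_on (scalar_integral_unique hS is_scalar_integral_kint)//.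
rewrite -[RHS]kint_indic; congr kint; apply/funext => x.
by rewrite mulrAC.
Qed.

End ScalarMeasureIntegral.

(** * Densities of a locally Pettis integrable function *)

Section Representation.
Context {R : realType} {k : scalar_kind}.
Local Notation K := (scalar_field R k).
Context {d : measure_display} {T : measurableType d}.
Context (mu : {measure set T -> \bar R}).
Context {X : normedModType K}.
Implicit Types (f g h : T -> K^o) (phi : topdual X) (F : T -> X).

(** The choice made by [mrep] is immaterial: any measurable version of [f] will
    do in its place. *)
Lemma mrep_ae f h : L0 h -> {ae mu, forall x, f x = h x} ->
  L0 (mrep mu f) /\ {ae mu, forall x, mrep mu f x = h x}.
Proof.
move=> Lh fh.
have [Lm fm] : L0 (mrep mu f) /\ {ae mu, forall x, f x = mrep mu f x}.
  by apply: (@xgetPex _ (cst 0) [set h : T -> K^o | L0 h /\ _]); exists h.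
by split=> //; apply: filterS2 fh fm => x -> ->.
Qed.

Lemma topdualZ phi (a : K) (y : X) : phi (a *: y) = a * phi y.
Proof. by rewrite linearZ. Qed.

Lemma exhausts_mul E g h : exhausts mu E h ->
  exhausts mu E (fun x => (g x : K) * h x).
Proof.
by move=> [fE ndE Eh]; split => // x gh; apply: Eh => h0; apply: gh; rewrite h0 mulr0.
Qed.

Lemma mult_map_ae F g phi h : {ae mu, forall x, phi (F x) = h x} ->
  {ae mu, forall x, (phi \o mult_map F g) x = (g x : K) * h x}.
Proof. by apply: filterS => x /= <-; rewrite topdualZ. Qed.

(** All that the argument uses of [F]: for each functional [phi], a measurable
    version [h] of [phi \o F] and the fact that the scalar measure
    [phi \o nu_F] has density [h]. *)
Definition is_density F phi E h :=
  [/\ L0 h, exhausts mu E h, {ae mu, forall x, phi (F x) = h x},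
      forall B, finite_sets mu B -> kintegrable mu B h &
      forall B, finite_sets mu B ->
        scalarize (pettis_measure mu F) phi B = kint mu B h].

Lemma locally_pettis_density F phi : locally_pettis mu F ->
  exists E h, is_density F phi E h.
Proof.
move=> [wF pF]; have /strongly_measurableP[h [E [Lh hE Fh]]] := wF phi.
exists E, h; have mrepB B : finite_sets mu B ->
    let m := mrep mu (phi \o (fun x => (\1_B x : K) *: F x)) in
    L0 m /\ {ae mu, forall x, m x = (h x : K) * (\1_B x : K^o)}.
  move=> [mB _]; apply: mrep_ae; first by apply: L0M => //; exact: L0_indic.
  by apply: filterS Fh => x /= <-; rewrite topdualZ mulrC.
split => // B fB; have [mB _] := fB; have [Lm mh] := mrepB _ fB.
  have [[_ /(_ phi) [_ fin]] _] := pF _ fB.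
  apply/kintegrableP => //; move: fin.
  rewrite (kint_norm_ae (g := fun x => (h x : K) * (\1_B x : K^o))) //.
  - rewrite [in X in _ -> X]integral_mkcond; congr (_ < _)%E.
    apply: eq_integral => x _; rewrite indic_mulE patchE.
    by case: ifP => //; rewrite kabs0.
  - by apply: L0M => //; exact: L0_indic.
  - by apply: filterS mh => x mx _.
have [_ /(_ B mB)] := pF _ fB.
move=> [y yB]; have ex : exists y, is_pettis_integral mu
    (fun x => (\1_B x : K) *: F x) B y by exists y.
rewrite /scalarize /pettis_measure /pettis_integral -(xgetPex 0 ex phi).
apply: kint_ae => //; apply: filterS mh => x -> Bx.
by rewrite indic_mulE mem_set.
Qed.

(** The semivariation only involves the unit ball of the dual; a continuous
    functional, being bounded, has a nonzero multiple there, with the same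
    zeros. *)
Lemma ball_scaling phi : exists2 psi : topdual X, dual_ball psi &
  forall y, psi y = 0 -> phi y = 0.
Proof.
have /linear_boundedP phib : bounded_near phi (nbhs (0 : X)).
  by apply/linear_bounded_continuous; exact: dual_continuous.
have [r [r0 hr]] : exists r : K, 0 < r /\ forall x, `|phi x| <= r * `|x|.
  have : \forall r \near +oo, 0 < r /\ forall x, `|phi x| <= r * `|x|.
    by near=> r; split; near: r => //; exact: nbhs_pinfty_gt.
  by move=> /filter_ex.
have cont : continuous (r^-1 \*: phi : X -> K^o).
  by move=> x; apply: continuousZl_tmp; exact: dual_continuous.
exists (TopDual cont) => [x x1|y] /=.
  rewrite normrZ normfV (gtr0_norm r0) ler_pdivrMl// mulr1.
  by rewrite (le_trans (hr x))// ler_piMr// ltW.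
by move=> /eqP; rewrite scaler_eq0 invr_eq0 gt_eqF//= => /eqP.
Unshelve. all: by end_near.
Qed.

End Representation.

(** * The multiplication map *)

Section MultiplicationMap.
Context {R : realType} {k : scalar_kind}.
Local Notation K := (scalar_field R k).
Context {d : measure_display} {T : measurableType d}.
Context (mu : {measure set T -> \bar R}).
Context {X : normedModType K} (F : T -> X).
Hypothesis pF : locally_pettis mu F.
Implicit Types (g : T -> K^o) (phi : topdual X).

Local Notation nuF := (pettis_measure mu F).
Local Notation var phi := (scalar_variation mu (scalarize nuF phi)).
Local Notation M := (mult_map F).

Lemma mult_map_rep g phi : L0 g ->
  exists E h, [/\ is_density mu F phi E h, L0 (fun x => (g x : K) * h x : K^o),
    L0 (mrep mu (phi \o M g)) &
    {ae mu, forall x, mrep mu (phi \o M g) x = (g x : K) * h x}].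
Proof.
move=> Lg; have [E [h dh]] := locally_pettis_density phi pF.
have [Lh _ Fh _ _] := dh.
have Lgh : L0 (fun x => (g x : K) * h x : K^o) by exact: L0M.
have [Lm mh] := mrep_ae Lgh (mult_map_ae g Fh).
by exists E, h.
Qed.

(** Both sides are the integral of [kabs (g x * h x)], where [h] is the density of
    [phi]. Integrability and norms agree on the two sides because of this. *)
Lemma integral_variation_mult_map g phi : L0 g ->
  (\int[mu]_x (kabs (mrep mu (phi \o M g) x : K))%:E =
   \int[var phi]_x (kabs (g x : K))%:E)%E.
Proof.
move=> Lg; have [E [h [[Lh hE _ hloc lamE] Lgh Lm mh]]] := mult_map_rep phi Lg.
rewrite (integral_variation Lh hE hloc lamE Lg).
by apply: kint_norm_ae => //; apply: filterS mh => x mx _.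
Qed.

Lemma L1fun_mult_map g phi : L0 g ->
  L1fun mu (mrep mu (phi \o M g)) <-> L1fun (var phi) g.
Proof.
move=> Lg; have [E [h [_ _ Lm _]]] := mult_map_rep phi Lg.
by rewrite /L1fun integral_variation_mult_map//; split=> -[].
Qed.

Lemma weakly_measurable_mult_map g : L0 g -> weakly_measurable mu (M g).
Proof.
move=> Lg phi; have [E [h [Lh hE Fh _ _]]] := locally_pettis_density phi pF.
apply/strongly_measurableP; exists (fun x => (g x : K) * h x), E; split.
- exact: L0M.
- exact: exhausts_mul.
- exact: mult_map_ae.
Qed.

Lemma dunford_mult_map g : L0 g -> L1w mu nuF g <-> dunford mu (M g).
Proof.
move=> Lg; split=> [[_ gL]|[_ gL]]; split.
- exact: weakly_measurable_mult_map.
- by move=> phi; apply/L1fun_mult_map.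
- by [].
- by move=> phi; apply/L1fun_mult_map.
Qed.

Lemma dunford_norm_mult_map g : L0 g ->
  dunford_norm mu (M g) = L1w_norm mu nuF g.
Proof.
move=> Lg; congr ereal_sup; apply: eq_imagel => phi _.
exact: integral_variation_mult_map.
Qed.

Lemma scalar_integral_mult_map A g phi : measurable A -> L1w mu nuF g ->
  scalar_integral_on mu (scalarize nuF phi) A g = kintegral mu A (phi \o M g).
Proof.
move=> mA [Lg gL].
have [E [h [[Lh hE _ hloc lamE] Lgh Lm mh]]] := mult_map_rep phi Lg.
rewrite (scalar_integral_onE Lh hE hloc lamE mA (gL phi)).
by apply: kint_ae => //; apply: filterS mh => x mx _.
Qed.

(** The two vector integrals are characterized by the same scalar integrals, so
    they have the same candidate values [y]. *)
Lemma vm_integral_mult_map A g y : measurable A -> L1w mu nuF g ->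
  is_vm_integral mu nuF g A y <-> is_pettis_integral mu (M g) A y.
Proof.
move=> mA gL; split=> gy phi; have := gy phi.
  by rewrite scalar_integral_mult_map.
by rewrite scalar_integral_mult_map.
Qed.

Lemma pettis_mult_map g : L0 g -> L1vm mu nuF g <-> pettis mu (M g).
Proof.
move=> Lg; split=> [[gL gA]|[gD gA]].
  split; first exact/dunford_mult_map.
  by move=> A mA; have [y /(vm_integral_mult_map _ mA gL)] := gA A mA; exists y.
have gL : L1w mu nuF g by exact/dunford_mult_map.
split=> // A mA; have [y gy] := gA A mA; exists y.
exact/vm_integral_mult_map.
Qed.

(** The semivariation of [N] dominates the variation for a functional of the unit
    ball, which is the integral over [N] of the modulus of its density. *)
Lemma vm_null_density N phi : vm_null mu nuF N ->
  {ae mu, forall x, N x -> phi (F x) = 0}.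
Proof.
move=> [mN N0]; have [psi psiB psi0] := ball_scaling phi.
have [E [h [Lh hE Fh hloc lamE]]] := locally_pettis_density psi pF.
have mh : measurable_fun N (EFin \o (fun x => kabs (h x : K))).
  exact/measurable_EFinP/measurable_funTS/L0_kabs.
have hN : (\int[mu]_(x in N) (kabs (h x : K))%:E = 0)%E.
  apply/eqP; rewrite eq_le; apply/andP; split.
    rewrite -(variation_kint Lh hE hloc lamE mN) -N0.
    by apply: ereal_sup_ubound; exists psi.
  by apply: integral_ge0 => x _; rewrite lee_fin kabs_ge0.
have : ae_eq mu N (EFin \o (fun x => kabs (h x : K))) (cst 0%E).
  apply/(ae_eq_integral_abs mu mN mh); rewrite -[RHS]hN.
  by apply: eq_integral => x _; rewrite /= ger0_norm ?kabs_ge0.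
apply: filterS2 Fh => x /= Fx hx /hx[] /kabs0_eq0 h0.
by apply: psi0; rewrite Fx.
Qed.

(** Off [N] the two functions agree, and almost everywhere on [N] the functional
    of [F] vanishes. *)
Lemma mult_map_eq f g : vm_ae_eq mu nuF f g -> weakly_ae_eq mu (M f) (M g).
Proof.
move=> [N nN fg] phi; apply: filterS (vm_null_density phi nN) => x Nx.
rewrite /mult_map !topdualZ; have [/Nx ->|/fg ->] := pselect (N x) => //.
by rewrite !mulr0.
Qed.

Lemma mult_map_lin (a : K) f g : M (a *: f + g) = a *: M f + M g.
Proof.
apply/funext => x; rewrite /mult_map scalerDl; congr (_ + _).
exact: esym (scalerA _ _ _).
Qed.

End MultiplicationMap.

Theorem theorem4p3 (R : realType) (k : scalar_kind)
    (d : measure_display) (Omega : measurableType d)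
    (mu : {measure set Omega -> \bar R})
    (X : completeNormedModType (scalar_field R k)) (F : Omega -> X) :
  locally_determined mu -> locally_pettis mu F ->
  let nuF := pettis_measure mu F in
  let M := mult_map F in
  (* (i) *)
  ((forall g : Omega -> (scalar_field R k)^o, L0 g ->
      (L1w mu nuF g <-> dunford mu (M g))) /\
   linear_isometry (L1w_space mu nuF) (Dunford_space mu X) M) /\
  (* (ii) *)
  ((forall g : Omega -> (scalar_field R k)^o, L0 g ->
      (L1vm mu nuF g <-> pettis mu (M g))) /\
   linear_isometry (L1_space mu nuF) (Pettis_space mu X) M /\
   (forall g : Omega -> (scalar_field R k)^o, L1vm mu nuF g ->
      vm_integral mu nuF setT g = pettis_integral mu setT (M g))).
Proof.
move=> _ pF nuF M.
have weak_refl (G : Omega -> X) : weakly_ae_eq mu G G.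
  by move=> phi; apply: aeW.
split; split.
- exact: dunford_mult_map.
- split=> [g gL|f g _ _|a f g _ _|g [Lg _]] /=.
  + by apply/(dunford_mult_map pF) => //; case: gL.
  + exact: mult_map_eq.
  + rewrite /M mult_map_lin; exact: weak_refl.
  + exact: dunford_norm_mult_map.
- exact: pettis_mult_map.
- split=> [|g [gL _]].
    split=> [g gL|f g _ _|a f g _ _|g [[Lg _] _]] /=.
    + by apply/(pettis_mult_map pF) => //; case: gL => -[].
    + exact: mult_map_eq.
    + rewrite /M mult_map_lin; exact: weak_refl.
    + exact: dunford_norm_mult_map.
  congr (xget 0); apply/seteqP; split => y /=.
    by move/(vm_integral_mult_map pF _ measurableT gL).
  by move/(vm_integral_mult_map pF _ measurableT gL).
Qed.
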